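(* There exists an absolute constant $C>0$ such that the following holds. Let $n>1$ be an integer, let $\varepsilon\in(0,n)$, let $\delta\geq 1/(n-\varepsilon)$, let $p>2$ be a prime, and let $A\subset\mathbb{Z}_p$ be a set with $|A|>p^\delta$. Then there is a positive integer $N$ with $$N\leq C\,4^n\log(2+1/\varepsilon)$$ such that $NA^n=\mathbb{Z}_p$.
   Context: $\mathbb{Z}_p$ denotes the field of residues modulo the prime $p$. For $X\subset\mathbb{Z}_p$ and $k\in\mathbb{N}$, $X^k=\{x_1\cdots x_k:\ x_1,\dots,x_k\in X\}$ is the $k$-fold product set and $kX=\{x_1+\dots+x_k:\ x_1,\dots,x_k\in X\}$ is the $k$-fold sumset; thus $NA^n$ is the $N$-fold sumset of the set $A^n$. $\log$ is the natural logarithm. *)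

(* Defs.v *)
From mathcomp Require Import all_boot all_order all_algebra.
From mathcomp Require Import reals exp.

Set Implicit Arguments.
Unset Strict Implicit.
Unset Printing Implicit Defensive.

Import Order.TTheory GRing.Theory Num.Theory.

Local Open Scope ring_scope.

Definition prodset (F : finComNzRingType) (k : nat) (X : {set F}) : {set F} :=
  [set \prod_(i < k) x i | x : {ffun 'I_k -> F} in ffun_on X].

Definition sumset (F : finComNzRingType) (k : nat) (X : {set F}) : {set F} :=
  [set \sum_(i < k) x i | x : {ffun 'I_k -> F} in ffun_on X].

(* Main.v *)
(* Write a = |A|, T_k(N) = N A^k, G_k = T_k((4^k - 1)/3), y_k = min(a^k, p).

   Differences.  If Q = (X - X)/(A - A) is all of Z_p, an averaging argument
   gives xi in Q with |X + xi A| >= |X||A|p/(|X||A| + p); otherwise some xi in Q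
   has xi + c outside Q, and then |X + (xi + c) A| = |X||A|.  Clearing the
   denominator of xi, with X = G_k - G_k and c in A^(k-1), places such a set inside
   G_(k+1) - G_(k+1).  By induction |G_k - G_k| >= y_k / 3.

   Removing the signs.  Ruzsa's inequality |G - G||V| <= |V + G|^2 shows that
   adding one more copy of G_k to V takes the square root of the deficit y_k/|V|
   (up to a constant).  Hence about log(1/eps) copies, rather than 1/eps, give
   U = T_n(.) and S = T_(n-1)(.) with, for e = min(eps, 1), |U| >= p a^(-e/2) / 3 and
   |S| >= y_(n-1) a^(-e/2) / 3, so that |U||S||A| >= p^2 / 9.  Averaging over b in A
   now gives |U + b S| >= p/10, and Cauchy-Davenport finishes. *)
Require Import Defs.
From HB Require Import structures.
From mathcomp Require Import all_boot all_order all_algebra.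
From mathcomp Require Import reals exp.
From mathcomp Require Import zify ring lra.

Set Implicit Arguments.
Unset Strict Implicit.
Unset Printing Implicit Defensive.

Import Order.TTheory GRing.Theory Num.Theory.

Local Open Scope ring_scope.

(** * Elements of sumsets and product sets *)

Lemma sumsetP (F : finComNzRingType) (N : nat) (X : {set F}) (z : F) :
  reflect (exists2 f : 'I_N -> F, (forall i, f i \in X) & z = \sum_i f i)
          (z \in sumset N X).
Proof.
apply: (iffP imsetP) => [[f /ffun_onP fX ->]|[f fX ->]]; first by exists f.
exists [ffun i => f i]; first by apply/ffun_onP => i; rewrite ffunE.
by apply: eq_bigr => i _; rewrite ffunE.
Qed.

Lemma prodsetP (F : finComNzRingType) (k : nat) (X : {set F}) (z : F) :
  reflect (exists2 f : 'I_k -> F, (forall i, f i \in X) & z = \prod_i f i)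
          (z \in prodset k X).
Proof.
apply: (iffP imsetP) => [[f /ffun_onP fX ->]|[f fX ->]]; first by exists f.
exists [ffun i => f i]; first by apply/ffun_onP => i; rewrite ffunE.
by apply: eq_bigr => i _; rewrite ffunE.
Qed.

Lemma sumset_add (F : finComNzRingType) (N M : nat) (X : {set F}) (x y : F) :
  x \in sumset N X -> y \in sumset M X -> x + y \in sumset (N + M) X.
Proof.
move=> /sumsetP[f fX ->] /sumsetP[g gX ->]; apply/sumsetP.
exists (fun i => match split i with inl j => f j | inr j => g j end).
  by move=> i; case: (split i) => j.
rewrite big_split_ord /=; congr (_ + _); apply: eq_bigr => i _.
  by case: splitP => j /= ij; [congr f; exact: val_inj | have := ltn_ord i; lia].
by case: splitP => j /= ij; [have := ltn_ord j; lia | congr g; apply: val_inj => /=; lia].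
Qed.

Lemma sumset1 (F : finComNzRingType) (X : {set F}) (x : F) :
  x \in X -> x \in sumset 1 X.
Proof. by move=> xX; apply/sumsetP; exists (fun=> x); rewrite ?big_ord1. Qed.

Lemma sumset_mulr (F : finComNzRingType) (N : nat) (X Y : {set F}) (a z : F) :
  (forall x, x \in X -> a * x \in Y) -> z \in sumset N X -> a * z \in sumset N Y.
Proof.
move=> XY /sumsetP[f fX ->]; apply/sumsetP; exists (fun i => a * f i).
  by move=> i; apply: XY.
by rewrite mulr_sumr.
Qed.

Lemma prodset1 (F : finComNzRingType) (X : {set F}) (x : F) :
  x \in X -> x \in prodset 1 X.
Proof. by move=> xX; apply/prodsetP; exists (fun=> x); rewrite ?big_ord1. Qed.

Lemma prodset_mulr (F : finComNzRingType) (k : nat) (X : {set F}) (a z : F) :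
  a \in X -> z \in prodset k X -> a * z \in prodset k.+1 X.
Proof.
move=> aX /prodsetP[f fX ->]; apply/prodsetP.
exists (fun i => if unlift ord0 i is Some j then f j else a).
  by move=> i; case: (unlift ord0 i) => [j|].
by rewrite big_ord_recl unlift_none; congr (_ * _); apply: eq_bigr => i _; rewrite liftK.
Qed.

Lemma prodset_exp (F : finComNzRingType) (k : nat) (X : {set F}) (a : F) :
  a \in X -> a ^+ k \in prodset k X.
Proof.
by move=> aX; apply/prodsetP; exists (fun=> a); rewrite // prodr_const card_ord.
Qed.

Lemma sumsetM (F : finComNzRingType) (N k : nat) (A : {set F}) (a z : F) :
  a \in A -> z \in sumset N (prodset k A) -> a * z \in sumset N (prodset k.+1 A).
Proof. by move=> aA; apply: sumset_mulr => x; apply: prodset_mulr. Qed.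

(** * Ruzsa's inequality and the Cauchy-Davenport theorem *)

Definition addset (F : finZmodType) (X Y : {set F}) : {set F} :=
  [set x + y | x in X, y in Y].

Definition diffset (F : finZmodType) (X Y : {set F}) : {set F} :=
  [set x - y | x in X, y in Y].

(** Fix for each d in [D] one representation d = x - y. Then (d, v) -> (v + x, v + y) is injective:
    subtracting the coordinates recovers d, hence x, hence v. *)
Lemma ruzsa_triangle (F : finZmodType) (G V : {set F}) :
  (#|diffset G G| * #|V| <= #|addset V G| ^ 2)%N.
Proof.
set D := diffset G G.
have Dx d : d \in D -> exists xy : F * F,
    [&& xy.1 \in G, xy.2 \in G & d == xy.1 - xy.2].
  by case/imset2P=> x y xG yG ->; exists (x, y); rewrite /= xG yG eqxx.
pose h d := odflt (0, 0) [pick xy : F * F | [&& xy.1 \in G, xy.2 \in G & d == xy.1 - xy.2]].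
have hP d : d \in D -> [/\ (h d).1 \in G, (h d).2 \in G & d = (h d).1 - (h d).2].
  move=> /Dx[xy xyP]; rewrite /h; case: pickP => [u /and3P[? ? /eqP]|/(_ xy)] //=.
  by rewrite xyP.
pose phi (u : F * F) := (u.2 + (h u.1).1, u.2 + (h u.1).2).
have phi_inj : {in setX D V &, injective phi}.
  move=> [d v] [d' v']; rewrite !inE /= => /andP[/hP[_ _ dE] _] /andP[/hP[_ _ dE'] _].
  rewrite /phi /= => -[e1 e2].
  have dd' : d = d'.
    rewrite dE dE' -(addrKA v) -[RHS](addrKA v').
    by rewrite ![_ + v]addrC ![_ + v']addrC e1 e2.
  by move: e1; rewrite dd' => /addIr ->.
rewrite -mulnn -!cardsX -(card_in_imset phi_inj).
apply/subset_leq_card/subsetP => _ /imsetP[[d v] + ->].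
rewrite inE /= => /andP[/hP[h1 h2 _] vV].
by rewrite inE /=; apply/andP; split; apply: imset2_f.
Qed.

Lemma card_addset_ger (F : finZmodType) (X Y : {set F}) (y : F) :
  y \in Y -> (#|X| <= #|addset X Y|)%N.
Proof.
move=> yY; rewrite -(card_imset (mem X) (addIr y)).
by apply/subset_leq_card/subsetP => _ /imsetP[x xX ->]; apply: imset2_f.
Qed.

Lemma addsetC (F : finZmodType) (X Y : {set F}) : addset X Y = addset Y X.
Proof.
apply/setP => z; apply/imset2P/imset2P => -[x y xX yY ->];
  by exists y x => //; rewrite addrC.
Qed.

Lemma Fp_closed_setT (p : nat) (Q : {set 'F_p}) (c : 'F_p) :
  c != 0 -> 0 \in Q -> (forall x, x \in Q -> x + c \in Q) -> Q = [set: 'F_p].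
Proof.
move=> c0 Q0 Qc; apply/setP => x; rewrite inE.
have Qn (n : nat) : n%:R * c \in Q.
  by elim: n => [|n IH]; rewrite ?mul0r // mulrSr mulrDl mul1r Qc.
by rewrite -(divfK c0 x) -[x / c]natr_Zp Qn.
Qed.

(** Induction on the size of [Y]. If [X] is stable under translation by a nonzero difference of [Y],
    it is the whole field. Otherwise a Dyson transform keeps the total size, shrinks [Y] and creates
    no new sums. *)
Lemma cauchy_davenport (p : nat) (X Y : {set 'F_p}) :
  prime p -> X != set0 -> Y != set0 ->
  (minn p (#|X| + #|Y| - 1) <= #|addset X Y|)%N.
Proof.
move=> pp; have [m] := ubnP #|Y|; elim: m X Y => // m IH X Y Ym X0 Y0.
have /set0Pn[b' b'Y] := Y0.
have [|Y1] := leqP #|Y| 1.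
  move=> Y1; apply: leq_trans (card_addset_ger X b'Y).
  by rewrite geq_min leq_subLR addnC leq_add2r Y1 orbT.
have /subsetPn[b bY bb'] : ~~ (Y \subset [set b']).
  by apply: contraTN Y1 => /subset_leq_card; rewrite cards1 -leqNgt.
rewrite inE in bb'; have d0 : b - b' != 0 by rewrite subr_eq0.
have [/forall_inP XQ|] := boolP [forall x in X, x + (b - b') \in X].
  have [x xX] := set0Pn _ X0.
  suff XT : X = setT.
    apply: leq_trans (card_addset_ger X b'Y).
    by rewrite XT cardsT card_Fp // geq_minl.
  have /setP XT : [set y | y + x \in X] = setT.
    apply: (Fp_closed_setT d0) => [|y]; rewrite !inE ?add0r // => /XQ.
    by rewrite addrAC.
  by apply/setP => z; have := XT (z - x); rewrite !inE subrK => ->.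
rewrite negb_forall => /existsP[a]; rewrite negb_imply => /andP[aX abX].
(* Dyson's e-transform: move the part of Y + e outside X from Y to X. *)
pose e := a - b'.
pose Ye := [set y + e | y in Y].
pose Y' := [set y in Y | y + e \in X].
have cYe : #|Ye| = #|Y| by apply: card_imset; apply: addIr.
have cY' : #|X :&: Ye| = #|Y'|.
  rewrite -(card_imset (mem Y') (addIr e)); apply: eq_card => z; rewrite inE.
  apply/andP/imsetP => [[zX /imsetP[y yY zE]]|[y]].
    by exists y => //; rewrite !inE yY -zE.
  by rewrite !inE => /andP[yY yX] ->; split=> //; apply: imset_f.
(* Translation by [e] sends b' to a, in [X], but b to a + (b - b'), outside [X]: hence [Y'] is
   nonempty and strictly smaller than [Y]. *)
have b'Y' : b' \in Y' by rewrite !inE b'Y /e addrC subrK.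
have bY' : b \notin Y' by rewrite !inE bY /e addrCA /= abX.
have ltY : (#|Y'| < #|Y|)%N.
  apply/proper_card/properP; split; last by exists b.
  by apply/subsetP => y; rewrite inE => /andP[].
have := IH (X :|: Ye) Y' (leq_trans ltY Ym) _ _.
have -> : (#|X :|: Ye| + #|Y'| = #|X| + #|Y|)%N.
  by rewrite -cY' cardsUI cYe.
move=> IH'; apply: leq_trans (IH' _ _) _.
  by case/set0Pn: X0 => x xX; apply/set0Pn; exists x; rewrite inE xX.
  by apply/set0Pn; exists b'.
apply/subset_leq_card/subsetP => _ /imset2P[x y xX yY' ->].
move: yY'; rewrite inE => /andP[yY yeX].
move: xX; rewrite inE => /orP[xX|/imsetP[y1 y1Y ->]]; first exact: imset2_f.
by rewrite -addrA [e + y]addrC addrC; apply: imset2_f.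
Qed.

(** * Collision counting and averaging over dilates *)

Lemma sqr_sum_le (T : finType) (S : {set T}) (f : T -> nat) :
  ((\sum_(i in S) f i) ^ 2 <= #|S| * \sum_(i in S) f i ^ 2)%N.
Proof.
rewrite -(leq_pmul2l (isT : 0 < 2)%N) -mulnn big_distrl /=.
under eq_bigr => i _ do rewrite big_distrr /=.
apply: (@leq_trans (\sum_(i in S) \sum_(j in S) (f i ^ 2 + f j ^ 2))%N).
  rewrite big_distrr; apply: leq_sum => i _.
  by rewrite big_distrr; apply: leq_sum => j _; apply: nat_Cauchy.
under eq_bigr => i _ do rewrite big_split /= sum_nat_const.
by rewrite big_split /= sum_nat_const -big_distrr /= mul2n addnn.
Qed.

(** Cauchy-Schwarz on the fibre sizes [r z]: they sum to #|U|, and their squares sum to the number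
    of colliding pairs. *)
Lemma sqr_card_le_collisions (T T' : finType) (U : {set T}) (f : T -> T') :
  (#|U| ^ 2 <= #|f @: U| * \sum_(u in U) \sum_(v in U) (f u == f v))%N.
Proof.
pose r z := (\sum_(u in U) (f u == z))%N.
have -> : #|U| = (\sum_(z in f @: U) r z)%N.
  rewrite exchange_big /= -sum1_card; apply: eq_bigr => u uU.
  rewrite (bigD1 (f u)) ?imset_f //= eqxx big1 ?addn0 // => z /andP[_].
  by rewrite eq_sym => /negbTE->.
apply: leq_trans (sqr_sum_le _ _) _; rewrite leq_mul2l; apply/orP; right.
under eq_bigr => z _ do rewrite -mulnn /r big_distrl /=.
rewrite exchange_big /=; apply: leq_sum => u uU.
under eq_bigr => z _ do rewrite big_distrr /=.
rewrite exchange_big /=; apply: leq_sum => v vU.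
rewrite (bigD1 (f u)) ?imset_f //= eqxx mul1n big1 ?addn0 1?eq_sym // => z /andP[_].
by rewrite eq_sym => /negbTE->.
Qed.

Definition dilsum (F : finFieldType) (b : F) (X Y : {set F}) : {set F} :=
  [set x + b * y | x in X, y in Y].

Lemma dilsumE (F : finFieldType) (b : F) (X Y : {set F}) :
  dilsum b X Y = [set u.1 + b * u.2 | u in setX X Y].
Proof.
apply/setP => z; apply/imset2P/imsetP => [[x y xX yY ->]|[[x y]]].
  by exists (x, y); rewrite // inE /= xX yY.
by rewrite inE /= => /andP[xX yY] ->; exists x y.
Qed.

(** With n = |X||Y| and q = |F|, the collision counts [E b] total at most n^2 + q n over all b, and
    each is at least n^2/q. If every b in [B] failed, each such [E b] would exceed n^2/q + q n/|B|,
    and the total would be too large. *)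
Lemma exists_large_dilsum (F : finFieldType) (B X Y : {set F}) :
  B != set0 ->
  exists2 b, b \in B &
    (#|F| * (#|X| * #|Y| * #|B|) <=
     #|dilsum b X Y| * (#|X| * #|Y| * #|B| + #|F| ^ 2))%N.
Proof.
move=> /set0Pn[b0 b0B]; apply/exists_inP; apply: contraT => nE; exfalso.
pose U := setX X Y.
pose E (b : F) := (\sum_(u in U) \sum_(v in U)
  ((u.1 + b * u.2)%R == (v.1 + b * v.2)%R))%N.
have nU : #|U| = (#|X| * #|Y|)%N by rewrite cardsX.
rewrite -nU in nE; set n := #|U| in nU nE; set q := #|F| in nE.
have E_ge b : (n ^ 2 <= #|dilsum b X Y| * E b)%N.
  by rewrite dilsumE; apply: sqr_card_le_collisions.
(* Distinct pairs collide for at most one b; each pair collides with itself for all q values of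
   b. *)
have E_sum : (\sum_b E b <= n ^ 2 + q * n)%N.
  rewrite exchange_big /=; under eq_bigr => u _ do rewrite exchange_big /=.
  have -> : (n ^ 2 + q * n = \sum_(u in U) \sum_(v in U) (1 + q * (u == v)))%N.
    under [RHS]eq_bigr => u uU.
      rewrite big_split /= sum1_card (bigD1 u) //= eqxx muln1 big1 ?addn0.
        over.
      by move=> v /andP[_]; rewrite eq_sym => /negbTE->; rewrite muln0.
    by rewrite sum_nat_const -/n mulnDr mulnn [(n * q)%N]mulnC.
  apply: leq_sum => u _; apply: leq_sum => v _.
  have [->|uv] := eqVneq u v.
    rewrite muln1 (eq_bigr (fun=> 1%N)) => [|b _]; last by rewrite eqxx.
    by rewrite sum1_card leq_addl.
  rewrite muln0 addn0 -big_mkcond /= sum1_card; apply/card_le1_eqP => b b'.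
  move=> /eqP e' /eqP e.
  have ee : (b - b') * (u.2 - v.2) = 0.
    rewrite (_ : _ * _ = (u.1 + b * u.2 - (v.1 + b * v.2)) -
      (u.1 + b' * u.2 - (v.1 + b' * v.2))); last by ring.
    by rewrite e e' !subrr.
  have /eqP := ee; rewrite mulf_eq0 !subr_eq0 => /orP[/eqP//|/eqP u2].
  case/eqP: uv; move: e; rewrite u2 => /addIr u1.
  by rewrite [u]surjective_pairing [v]surjective_pairing u1 u2.
move: nE; rewrite negb_exists => /forallP nE.
have lt b : b \in B -> (n * (n * #|B| + q ^ 2) < E b * (q * #|B|))%N.
  move=> bB; have := nE b; rewrite bB -ltnNge /= => {}nE.
  have n0 : (0 < n)%N by rewrite lt0n; apply: contraTN nE => /eqP->; rewrite !mul0n muln0.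
  have := E_ge b.
  have E0 : (0 < E b)%N.
    by rewrite lt0n; apply/negP => /eqP E0; have := E_ge b; rewrite E0; nia.
  move: nE; set s := #|dilsum _ _ _|; set e := E b; move=> h1 h2.
  rewrite -(ltn_pmul2l n0).
  apply: (@leq_ltn_trans (e * (s * (n * #|B| + q ^ 2)))%N).
    by rewrite !mulnA [(e * s)%N]mulnC leq_mul2r mulnn h2 orbT.
  have -> : (n * (e * (q * #|B|)) = e * (q * (n * #|B|)))%N by lia.
  by rewrite ltn_pmul2l.
(* The added 1 keeps the strictness on which the final contradiction rests. *)
have s1 : (\sum_(b in B) (n * (n * #|B| + q ^ 2) + 1) <= \sum_(b in B) E b * (q * #|B|))%N.
  by apply: leq_sum => b bB; rewrite addn1 lt.
have s2 : (\sum_(b in ~: B) n ^ 2 <= \sum_(b in ~: B) q * E b)%N.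
  apply: leq_sum => b _; apply: leq_trans (E_ge b) _.
  by rewrite leq_mul2r max_card orbT.
have sB : (\sum_b E b = \sum_(b in B) E b + \sum_(b in ~: B) E b)%N.
  by rewrite (bigID (mem B)) /=; congr addn; apply: eq_bigl => b; rewrite inE.
have cB := cardsC B; rewrite -/q in cB.
move: s1 s2; rewrite !sum_nat_const -big_distrl -big_distrr /=.
have B0 : (0 < #|B|)%N by apply/card_gt0P; exists b0.
move: E_sum; rewrite sB; move: cB B0.
move: (#|B|) (#|~: B|) (\sum_(b in B) E b)%N (\sum_(b in ~: B) E b)%N => k l SB SC.
move=> kl k0 h h1 h2.
have {h1} : (n * (n * k + q ^ 2) + 1 <= SB * q)%N.
  by rewrite -(leq_pmul2l k0); nia.
have : (q * (SB + SC) <= q * (n ^ 2 + q * n))%N by rewrite leq_mul2l h orbT.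
have : (k * n ^ 2 + l * n ^ 2 = q * n ^ 2)%N by rewrite -mulnDl kl.
rewrite -!mulnn in h h2 *; lia.
Qed.

(** * Growth of the difference sets *)

Lemma nonzero_mem (F : finFieldType) (A : {set F}) :
  (1 < #|A|)%N -> exists2 a, a \in A & a != 0.
Proof.
case/card_gt1P => a [a' [aA a'A aa']].
by have [a0|] := eqVneq a 0; [exists a' => //; rewrite -a0 eq_sym | exists a].
Qed.

(** The set counted is (a1 - a2)(X + xi A) with xi = (x1 - x2)/(a1 - a2), plus c when [t] holds.
    Either the ratio set [Q] is stable under adding c, so it is the field and averaging applies ([t]
    false), or xi + c leaves [Q] and the sum is direct ([t] true). *)
Lemma exists_large_ratio_sum (p : nat) (X A : {set 'F_p}) (c : 'F_p) :
  prime p -> c != 0 -> X != set0 -> (1 < #|A|)%N ->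
  exists (a1 a2 x1 x2 : 'F_p) (t : bool),
    [/\ a1 \in A, a2 \in A, x1 \in X, x2 \in X &
     (p * (#|X| * #|A|) <=
      #|[set (a1 - a2)%R * x + (x1 - x2 + (c * (a1 - a2)) *+ t)%R * a
          | x in X, a in A]%R| * (#|X| * #|A| + p))%N].
Proof.
move=> pp c0 /set0Pn[x0 x0X] A1.
have /card_gt1P[a0 [a0' [a0A a0'A a00']]] := A1.
pose isratio (xi x1 x2 a1 a2 : 'F_p) :=
  [&& x1 \in X, x2 \in X, a1 \in A, a2 \in A, a1 != a2 & xi * (a1 - a2) == x1 - x2].
pose Q := [set xi | [exists x1, exists x2, exists a1, exists a2,
  isratio xi x1 x2 a1 a2]].
have QP xi : reflect (exists x1 x2 a1 a2, isratio xi x1 x2 a1 a2) (xi \in Q).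
  rewrite inE; apply: (iffP existsP) => [[x1 /existsP[x2 /existsP[a1 /existsP[a2 H]]]]|].
    by exists x1, x2, a1, a2.
  move=> [x1 [x2 [a1 [a2 H]]]]; exists x1; apply/existsP; exists x2.
  by apply/existsP; exists a1; apply/existsP; exists a2.
(* A collision with y1 != y2 would exhibit xi as the ratio (x2 - x1)/(y1 - y2). *)
have Qfst xi x1 x2 y1 y2 : x1 \in X -> x2 \in X -> y1 \in A -> y2 \in A ->
    x1 + xi * y1 = x2 + xi * y2 -> xi \notin Q -> (x1, y1) = (x2, y2).
  move=> x1X x2X y1A y2A e; have [y12|y12] := eqVneq y1 y2.
    by move: e; rewrite y12 => /addIr->.
  case/QP; exists x2, x1, y1, y2; rewrite /isratio x1X x2X y1A y2A y12 /=.
  rewrite -subr_eq0 (_ : _ - _ = (x1 + xi * y1) - (x2 + xi * y2)); last by ring.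
  by rewrite e subrr.
suff [xi [x1 [x2 [a1 [a2 [t [x1X x2X a1A a2A [a12 xiE lexi]]]]]]]] :
    exists (xi x1 x2 a1 a2 : 'F_p) (t : bool),
    [/\ x1 \in X, x2 \in X, a1 \in A, a2 \in A &
     [/\ a1 != a2, xi * (a1 - a2) = x1 - x2 + (c * (a1 - a2)) *+ t &
      (p * (#|X| * #|A|) <= #|dilsum xi X A| * (#|X| * #|A| + p))%N]].
  exists a1, a2, x1, x2, t; split=> //; rewrite -xiE.
  have u0 : a1 - a2 != 0 by rewrite subr_eq0.
  apply: leq_trans lexi _; rewrite leq_mul2r; apply/orP; right.
  rewrite -(card_imset (mem (dilsum xi X A)) (mulfI u0)).
  apply/subset_leq_card/subsetP => _ /imsetP[_ /imset2P[x a xX aA ->] ->].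
  by rewrite mulrDr mulrA [_ * xi]mulrC; apply: imset2_f.
have Q0 : 0 \in Q.
  apply/QP; exists x0, x0, a0, a0'.
  by rewrite /isratio x0X a0A a0'A a00' mul0r subrr /=.
have [/forall_inP Qc|] := boolP [forall xi in Q, xi + c \in Q].
  have QT := Fp_closed_setT c0 Q0 Qc.
  have T0 : [set: 'F_p] != set0 by apply/set0Pn; exists 0; rewrite inE.
  have [xi _ lexi] := exists_large_dilsum X A T0.
  have : xi \in Q by rewrite QT inE.
  case/QP => x1 [x2 [a1 [a2 /and5P[x1X x2X a1A a2A /andP[a12 /eqP xiE]]]]].
  exists xi, x1, x2, a1, a2, false; split=> //; rewrite addr0; split=> //.
  move: lexi; rewrite cardsT card_Fp // => lexi.
  (* Averaging over all p dilates gives the wanted inequality multiplied by p. *)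
  by rewrite -(leq_pmul2r (prime_gt0 pp)) -mulnA -[leqRHS]mulnA mulnDl mulnn.
rewrite negb_forall => /existsP[xi]; rewrite negb_imply => /andP[xiQ xicQ].
case/QP: xiQ => x1 [x2 [a1 [a2 /and5P[x1X x2X a1A a2A /andP[a12 /eqP xiE]]]]].
exists (xi + c), x1, x2, a1, a2, true; split=> //; split=> //.
  by rewrite mulrDl xiE.
have -> : #|dilsum (xi + c) X A| = (#|X| * #|A|)%N.
  rewrite dilsumE card_in_imset ?cardsX // => -[x y] [x' y'].
  rewrite !inE /= => /andP[xX yA] /andP[x'X y'A] e.
  exact: Qfst xX x'X yA y'A e xicQ.
by rewrite mulnC leq_mul2l leq_addl orbT.
Qed.

(* (4^k - 1)/3 *)
Fixpoint diff_order (k : nat) : nat :=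
  if k is k'.+1 then (4 * diff_order k' + 1)%N else 0%N.

Lemma diff_orderE (k : nat) : (3 * diff_order k + 1 = 4 ^ k)%N.
Proof. by elim: k => //= k IH; rewrite expnS -IH; lia. Qed.

Lemma diff_orderS (k : nat) :
  diff_order k.+1 = (diff_order k + diff_order k + diff_order k + diff_order k + 1)%N.
Proof. by rewrite /=; lia. Qed.

Notation powsum A k N := (sumset N (prodset k A)).
Notation posset A k := (powsum A k (diff_order k)).

(** In reciprocals: 1/s <= 1/r + 2/p and 1/s' <= 1/p + 1/(s al) give 1/s' <= 1/(al r) + (1 +
    2/al)/p, and 1 + 2/al <= 2 because al >= 2. *)
Lemma large_difference_arith (p s s' r al : nat) :
  (0 < p)%N -> (1 < al)%N -> (p * r <= s * (p + 2 * r))%N ->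
  (p * (s * al) <= s' * (s * al + p))%N ->
  (p * (al * r) <= s' * (p + 2 * (al * r)))%N.
Proof.
move=> p0 al1 IH leD.
rewrite -(@leq_pmul2r (s * al + p)); last by rewrite addn_gt0 p0 orbT.
apply: (@leq_trans (p * (s * al) * (p + 2 * (al * r)))%N); last first.
  by rewrite [leqRHS]mulnAC leq_mul2r leD orbT.
have h1 : (p * r <= s * p + s * r * al)%N by nia.
have : (p * al * (p * r + s * r * al) <= p * al * (s * p + 2 * (s * r * al)))%N.
  by rewrite leq_mul2l; apply/orP; right; lia.
lia.
Qed.

(** The bound 1/|D| <= 1/r + 2/p, with r the power of #|A|, passes through the induction with no
    loss; the factor 3 appears only when it is turned into a minimum. *)
Lemma large_difference_set_rec (p : nat) (A : {set 'F_p}) (k : nat) :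
  prime p -> (1 < #|A|)%N ->
  (p * #|A| ^ k.+1 <=
   #|diffset (posset A k.+1) (posset A k.+1)| * (p + 2 * #|A| ^ k.+1))%N.
Proof.
move=> pp A1; elim: k => [|k IH].
  have [a aA] : exists a, a \in A by apply/card_gt0P; apply: ltnW.
  rewrite expn1; apply: leq_trans (_ : (#|A| * (p + 2 * #|A|) <= _)%N).
    by rewrite mulnDr [(#|A| * p)%N]mulnC leq_addr.
  rewrite leq_mul2r; apply/orP; right.
  rewrite -(card_imset (mem A) (addIr (- a))).
  apply/subset_leq_card/subsetP => _ /imsetP[x xA ->]; rewrite /=.
  by apply: imset2_f; apply: sumset1; apply: prodset1.
have [a0 a0A a00] := nonzero_mem A1.
set N := diff_order k.+1 in IH *.
set D := diffset _ _ in IH.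
have D0 : D != set0.
  apply/set0Pn; exists 0; rewrite -(subrr (\sum_(i < N) a0 ^+ k.+1)).
  by apply: imset2_f; apply/sumsetP; exists (fun=> a0 ^+ k.+1) => // _; apply: prodset_exp.
have [a1 [a2 [x1 [x2 [t [a1A a2A x1D x2D leD]]]]]] :=
  exists_large_ratio_sum pp (expf_neq0 k a00) D0 A1.
set D' := imset2 _ _ _ in leD.
have D'D : D' \subset diffset (posset A k.+2) (posset A k.+2).
  apply/subsetP => _ /imset2P[x a xD aA ->].
  case/imset2P: xD => g h gP hP ->.
  case/imset2P: x1D => g1 h1 g1P h1P ->.
  case/imset2P: x2D => g2 h2 g2P h2P ->.
  (* Each side of the difference consists of four sums of [N] products, each multiplied by an
     element of [A], and one product coming from [c]: hence the recursion 4N + 1. *)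
  rewrite diff_orderS -/N.
  have c1 b : b \in A -> a0 ^+ k * b * a \in powsum A k.+2 1.
    move=> bA; apply: sumset1; rewrite mulrC; apply: prodset_mulr => //.
    by rewrite mulrC; apply: prodset_mulr => //; apply: prodset_exp.
  (* When t is false, the term a0^k a1 a is added on both sides, so that the
     number of summands does not depend on t. *)
  apply/imset2P; exists
      (a1 * g + a2 * h + a * g1 + a * h2 + a0 ^+ k * a1 * a)
      (a1 * h + a2 * g + a * h1 + a * g2 + a0 ^+ k * (if t then a2 else a1) * a).
  - by do 4?apply: sumset_add; rewrite ?c1 ?sumsetM.
  - by do 4?apply: sumset_add; rewrite ?c1 ?sumsetM //; case: (t).
  by case: (t) => /=; rewrite ?mulr1n ?mulr0n; ring.
apply: leq_trans (_ : (#|D'| * (p + 2 * #|A| ^ k.+2) <= _)%N); last first.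
  by rewrite leq_mul2r subset_leq_card ?orbT.
rewrite [(_ ^ k.+2)%N]expnS.
exact: large_difference_arith (prime_gt0 pp) A1 IH leD.
Qed.

Lemma large_difference_set (p : nat) (A : {set 'F_p}) (k : nat) :
  prime p -> (1 < #|A|)%N ->
  (minn (#|A| ^ k.+1) p <= 3 * #|diffset (posset A k.+1) (posset A k.+1)|)%N.
Proof.
move=> pp A1; have := large_difference_set_rec k pp A1.
have := prime_gt0 pp; have : (0 < #|A| ^ k.+1)%N by rewrite expn_gt0 ltnW.
move: (#|diffset _ _|) (#|A| ^ k.+1)%N => s r r0 p0 h.
have [rp|pr] := leqP r p; first by rewrite -(leq_pmul2l p0); nia.
by rewrite -(leq_pmul2r r0); nia.
Qed.

(** * From difference sets to sumsets *)

Lemma addset_subW (F : finComNzRingType) (X U V : {set F}) (N M : nat) :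
  U \subset sumset N X -> V \subset sumset M X ->
  addset U V \subset sumset (N + M) X.
Proof.
move=> /subsetP UX /subsetP VX; apply/subsetP => _ /imset2P[u v uU vV ->].
by apply: sumset_add; [apply: UX | apply: VX].
Qed.

Lemma minnX_ratio (al p k : nat) :
  (0 < al)%N -> (minn (al ^ k.+1) p <= al * minn (al ^ k) p)%N.
Proof.
move=> al0; rewrite expnS minnMr leq_min geq_minl /=.
by apply: leq_trans (geq_minr _ _) _; apply: leq_pmull.
Qed.

(** Starting point of the square-root iteration: a deficit of at most #|A|. By Ruzsa, |P' + G|^2 >=
    |D||P'|, where |D| >= y/3 and, by induction and [minnX_ratio], |P'| >= y/(3 |A|^2), y being the
    new minimum. *)
Lemma large_powsum (p : nat) (A : {set 'F_p}) (k : nat) :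
  prime p -> (1 < #|A|)%N ->
  exists2 c, (c <= 2 * 4 ^ k.+1)%N &
    (minn (#|A| ^ k.+1) p <= 3 * #|powsum A k.+1 c| * #|A|)%N.
Proof.
move=> pp A1; have A0 : (0 < #|A|)%N by apply: ltnW.
elim: k => [|k [c c_le IH]].
  exists 1%N => //; apply: leq_trans (geq_minl _ _) _.
  rewrite expn1 leq_pmull // muln_gt0 /=.
  apply: leq_trans A0 _; apply/subset_leq_card/subsetP => x xA.
  by apply: sumset1; apply: prodset1.
have [a aA a0] := nonzero_mem A1.
have Dge := large_difference_set k.+1 pp A1.
set G := posset A k.+2 in Dge; set D := diffset G G in Dge.
pose P' := [set a * x | x in powsum A k.+1 c].
have cP' : #|P'| = #|powsum A k.+1 c| by apply: card_imset; apply: mulfI.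
exists (c + diff_order k.+2)%N.
  by have := diff_orderE k.+2; rewrite (expnS 4 k.+1); lia.
have sub : addset P' G \subset powsum A k.+2 (c + diff_order k.+2).
  apply: addset_subW => //; apply/subsetP => _ /imsetP[x xP ->].
  exact: sumsetM.
apply: leq_trans (_ : (3 * #|addset P' G| * #|A| <= _)%N); last first.
  by rewrite leq_mul2r leq_mul2l subset_leq_card ?orbT.
have Rz := ruzsa_triangle G P'; rewrite -/D cP' in Rz.
rewrite -leq_sqr.
apply: leq_trans (_ : (3 * #|D| * (#|A| * (3 * #|powsum A k.+1 c| * #|A|)) <= _)%N).
  rewrite -mulnn leq_mul //; apply: leq_trans (minnX_ratio p k.+1 A0) _.
  by rewrite leq_mul2l IH orbT.
rewrite !expnMn; move: Rz.
move: (#|D|) (#|powsum _ _ c|) (#|addset _ _| ^ 2)%N => d x s ds.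
have -> : (3 * d * (#|A| * (3 * x * #|A|)) = 3 ^ 2 * #|A| ^ 2 * (d * x))%N by lia.
by rewrite [leqRHS]mulnAC leq_mul2l ds orbT.
Qed.

(** This is y <= 3 |V| |A|^(1/2^j), raised to the power 2^j to stay in the integers. Adding [G]
    halves the exponent of |A|, since (3|V + G|)^2 >= 3|D| * 3|V| >= y * 3|V|. *)
Lemma larger_powsum (p : nat) (A : {set 'F_p}) (k j : nat) :
  prime p -> (1 < #|A|)%N ->
  exists2 c, (c <= (j + 2) * 4 ^ k.+1)%N &
    (minn (#|A| ^ k.+1) p ^ (2 ^ j) <=
     (3 * #|powsum A k.+1 c|) ^ (2 ^ j) * #|A|)%N.
Proof.
move=> pp A1; elim: j => [|j [c c_le IH]].
  by have [c c_le H] := large_powsum k pp A1; exists c; rewrite ?expn1.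
have Dge := large_difference_set k pp A1.
set G := posset A k.+1 in Dge; set D := diffset G G in Dge.
set V := powsum A k.+1 c in IH; set y := minn _ _ in IH Dge *.
exists (c + diff_order k.+1)%N.
  by have := diff_orderE k.+1; move: c_le; rewrite !mulnDl; lia.
have sub : addset V G \subset powsum A k.+1 (c + diff_order k.+1).
  exact: addset_subW.
apply: leq_trans (_ : ((3 * #|addset V G|) ^ (2 ^ j.+1) * #|A| <= _)%N); last first.
  by rewrite leq_mul2r leq_exp2r ?expn_gt0 // leq_mul2l subset_leq_card ?orbT.
have Rz := ruzsa_triangle G V; rewrite -/D in Rz.
rewrite expnS !expnM.
apply: leq_trans (_ : ((3 * #|D|) ^ (2 ^ j) * ((3 * #|V|) ^ (2 ^ j) * #|A|) <= _)%N).
  by rewrite -mulnn expnMn leq_mul // leq_exp2r ?expn_gt0.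
rewrite mulnA leq_mul2r -expnMn leq_exp2r ?expn_gt0 // orbC.
by rewrite mulnACA expnMn leq_mul2l Rz.
Qed.

(** * Filling the whole field *)

Lemma cauchy_davenport_sumset (p : nat) (X : {set 'F_p}) (c i : nat) :
  prime p -> sumset c X != set0 ->
  (minn p (i * (#|sumset c X| - 1) + 1) <= #|sumset (i * c) X|)%N.
Proof.
move=> pp W0; have W1 : (0 < #|sumset c X|)%N by rewrite card_gt0.
elim: i => [|i IH].
  apply: leq_trans (geq_minr _ _) _; rewrite !mul0n add0n card_gt0.
  apply/set0Pn; exists 0; apply/sumsetP; exists (fun=> 0); last by rewrite big_ord0.
  by case.
have V0 : sumset (i * c) X != set0.
  by rewrite -card_gt0; apply: leq_trans IH; rewrite leq_min prime_gt0 // addn1.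
rewrite [(i.+1 * c)%N]mulSnr.
have CD := cauchy_davenport pp V0 W0.
have sub : addset (sumset (i * c) X) (sumset c X) \subset sumset (i * c + c) X.
  exact: addset_subW.
apply: (leq_trans _ (subset_leq_card sub)); apply: (leq_trans _ CD).
have : (0 < #|sumset (i * c) X|)%N by rewrite card_gt0.
move: IH W1; move: (#|sumset (i * c) X|) (#|sumset c X|) => v w.
move=> IH w0 v0; nia.
Qed.

(** Taking M-th roots, 9 u s al >= p y al^(1 - 2/M) with y = min(al^(k+1), p). If y is the power of
    al, [hp] bounds the rest below by p; if y = p, it suffices that M >= 2. *)
Lemma sqr_le_of_deficits (p al u s k M : nat) :
  (1 < al)%N -> (1 < M)%N ->
  (p ^ M * al ^ 2 <= al ^ (k.+2 * M))%N ->
  (minn (al ^ k.+2) p ^ M <= (3 * u) ^ M * al)%N ->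
  (minn (al ^ k.+1) p ^ M <= (3 * s) ^ M * al)%N ->
  (p ^ 2 <= 9 * (u * s * al))%N.
Proof.
move=> al1 M1 hp hu hs; have M0 : (0 < M)%N by apply: ltnW.
have al0 : (0 < al)%N by apply: ltnW.
have pal : (p <= al ^ k.+2)%N.
  rewrite -(leq_exp2r _ _ M0) -expnM; apply: leq_trans hp.
  by apply: leq_pmulr; rewrite expn_gt0 al0.
rewrite (minn_idPr pal) in hu.
rewrite -(leq_exp2r _ _ M0) -(@leq_pmul2r (al ^ 2)) ?expn_gt0 ?al0 //.
have -> : ((9 * (u * s * al)) ^ M * al ^ 2 =
           ((3 * u) ^ M * al) * (((3 * s) ^ M * al) * al ^ M))%N.
  by rewrite (_ : 9 = 3 * 3)%N // !expnMn -mulnn; lia.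
apply: leq_trans (leq_mul hu (leq_mul hs (leqnn _))).
rewrite -[(p ^ 2)%N]mulnn expnMn -mulnA leq_mul2l -expnMn; apply/orP; right.
have [_|_] := leqP (al ^ k.+1) p.
  by rewrite -expnSr -expnM.
by rewrite expnMn leq_mul2l leq_exp2l // M1 orbT.
Qed.

Lemma powsum_eq_setT (p : nat) (A : {set 'F_p}) (k j : nat) :
  prime p -> (1 < #|A|)%N -> (0 < j)%N ->
  (p ^ (2 ^ j) * #|A| ^ 2 <= #|A| ^ (k.+2 * 2 ^ j))%N ->
  exists N, [/\ (0 < N)%N, (N <= 140 * j * 4 ^ k.+2)%N &
    powsum A k.+2 N = [set: 'F_p]].
Proof.
move=> pp A1 j0 hp.
have [cu cu_le Uge] := larger_powsum k.+1 j pp A1.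
have [cs cs_le Sge] := larger_powsum k j pp A1.
have j2 : (1 < 2 ^ j)%N by rewrite -{1}(expn0 2) ltn_exp2l.
have := sqr_le_of_deficits A1 j2 hp Uge Sge.
set U := powsum A k.+2 cu; set S := powsum A k.+1 cs => p2.
have A0 : A != set0 by rewrite -card_gt0 ltnW.
have [a aA] := exists_large_dilsum U S A0; rewrite card_Fp // => dil_ge.
have [a0 a0A a00] := nonzero_mem A1.
pose Z := [set a0 ^+ k.+1 * x | x in A].
have cZ : #|Z| = #|A| by apply: card_imset; apply: mulfI; apply: expf_neq0.
(* Adding Z guarantees |W| > 1, without which Cauchy-Davenport is void; the
   bound |W| >= p/10 does not when p <= 10. *)
pose W := powsum A k.+2 (cu + cs + 1).
have dilW : addset (dilsum a U S) Z \subset W.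
  apply: addset_subW; apply/subsetP => z.
    by case/imset2P=> x y xU yS ->; apply: sumset_add => //; apply: sumsetM.
  case/imsetP=> x xA ->; apply: sumset1; rewrite mulrC.
  by apply: prodset_mulr => //; apply: prodset_exp.
have m0 : (0 < #|U| * #|S| * #|A|)%N.
  have : (0 < 9 * (#|U| * #|S| * #|A|))%N.
    by apply: leq_trans p2; rewrite expn_gt0 prime_gt0.
  by rewrite muln_gt0.
(* With m = |U||S||A|, [p2] gives m + p^2 <= 10 m, and m cancels. *)
have dil10 : (p <= 10 * #|dilsum a U S|)%N.
  rewrite -(leq_pmul2r m0); apply: leq_trans dil_ge _.
  rewrite -[leqRHS]mulnA [leqRHS]mulnCA leq_mul2l; apply/orP; right.
  by rewrite (_ : 10 = 1 + 9)%N // mulnDl mul1n leq_add2l.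
have /card_gt0P[d dD] : (0 < #|dilsum a U S|)%N.
  by have := leq_trans (prime_gt0 pp) dil10; rewrite muln_gt0.
have /card_gt0P[z zZ] : (0 < #|Z|)%N by rewrite cZ ltnW.
have W2 : (1 < #|W|)%N.
  rewrite -cZ in A1; apply: leq_trans A1 _.
  apply: leq_trans (card_addset_ger Z dD) _.
  by rewrite addsetC; apply: subset_leq_card.
have W10 : (p <= 10 * #|W|)%N.
  apply: leq_trans dil10 _; rewrite leq_mul2l /=.
  by apply: leq_trans (card_addset_ger _ zZ) _; apply: subset_leq_card.
have W0 : W != set0 by rewrite -card_gt0 ltnW.
(* Since |W| >= 2, 20(|W| - 1) >= 10 |W| >= p, so 20 copies of [W] suffice. *)
exists (20 * (cu + cs + 1))%N; split; first by rewrite muln_gt0 addn1.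
  have := expn_gt0 4 k.+1; move: cu_le cs_le; rewrite (expnS 4 k.+1).
  move: (4 ^ k.+1)%N => q; nia.
apply/eqP; rewrite eqEcard subsetT cardsT card_Fp //.
apply: leq_trans (cauchy_davenport_sumset 20 pp W0).
rewrite -/W leq_min leqnn /=; move: W2 W10; move: (#|W|) => w; lia.
Qed.

(** * Choice of the parameters and conclusion *)

Lemma natr_deficit (R : realType) (p al n M : nat) (eps delta : R) :
  0 < eps -> eps < n%:R -> 1 / (n%:R - eps) <= delta -> (0 < p)%N ->
  p%:R `^ delta < al%:R -> 2 <= M%:R * eps ->
  (1 < al)%N /\ (p ^ M * al ^ 2 <= al ^ (n * M))%N.
Proof.
move=> eps0 epsn ledelta p0 pal M2.
have d0 : 0 < n%:R - eps by rewrite subr_gt0.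
have p1 : 1 <= p%:R :> R by rewrite ler1n.
have lep : p%:R `^ (1 / (n%:R - eps)) <= al%:R.
  by apply: ltW; apply: le_lt_trans pal; apply: ler_powR.
have al1 : (1 < al)%N.
  rewrite -(ltr1n R); apply: le_lt_trans pal; rewrite -[leLHS](powRr0 p%:R).
  by apply: ler_powR => //; apply: le_trans ledelta; rewrite divr_ge0 ?ler01 // ltW.
split=> //; rewrite -(ler_nat R) natrM !natrX.
have al1R : 1 <= al%:R :> R by rewrite ler1n ltnW.
have al0R : 0 <= al%:R :> R by [].
(* Raised to the power M this leaves a factor al^(M eps) to spare, which absorbs al^2 because M eps
   >= 2. *)
have lep2 : p%:R <= al%:R `^ (n%:R - eps) :> R.
  have -> : p%:R = (p%:R `^ (1 / (n%:R - eps))) `^ (n%:R - eps) :> R.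
    by rewrite -powRrM divfK ?gt_eqF // powRr1.
  by apply: ge0_ler_powR; rewrite ?nnegrE ?powR_ge0 // ltW.
apply: (@le_trans _ _ ((al%:R `^ (n%:R - eps)) ^+ M * al%:R ^+ 2)).
  by rewrite ler_wpM2r ?exprn_ge0 // lerXn2r ?nnegrE ?powR_ge0.
rewrite -powR_mulrn ?powR_ge0 // -powRrM -!powR_mulrn // -powRD; last first.
  by rewrite pnatr_eq0 -lt0n (ltnW al1) implybT.
apply: ler_powR => //; rewrite natrM mulrBl -addrA gerDl addrC subr_le0.
by rewrite mulrC.
Qed.

(** Take the least j with 2^j >= 2 + 2/eps; the summand 2 forces j > 0. With L = 2 + 1/eps,
    minimality gives 2^j <= 4 L, so j ln 2 <= 2 ln 2 + ln L <= 3 ln L. *)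
Lemma exists_dyadic_scale (R : realType) (eps : R) :
  0 < eps ->
  exists j : nat, [/\ (0 < j)%N, 2 <= (2 ^ j)%:R * eps &
    j%:R * ln 2 <= 3 * ln (2 + 1 / eps)].
Proof.
move=> eps0.
have ieps : 0 < eps^-1 by rewrite invr_gt0.
have ex : exists j, 2 + 2 / eps <= (2 ^ j)%:R :> R.
  exists (Num.bound (2 + 2 / eps)); apply: ltW.
  have b0 : 0 <= 2 + 2 / eps by apply: addr_ge0 => //; apply: mulr_ge0 => //; apply: ltW.
  apply: lt_le_trans (archi_boundP b0) _; rewrite ler_nat; apply: ltnW; exact: ltn_expl.
case: (ex_minnP ex) => j hj jmin.
have j0 : (0 < j)%N.
  rewrite lt0n; apply/negP => /eqP j0; move: hj; rewrite j0 expn0.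
  have : 0 < 2 / eps by apply: mulr_gt0.
  lra.
exists j; split=> //.
  rewrite -ler_pdivrMr //; apply: le_trans hj; lra.
have lt4 : (2 ^ j)%:R <= 4 * (2 + 1 / eps) :> R.
  have : ~~ (2 + 2 / eps <= (2 ^ j.-1)%:R :> R).
    by apply/negP => /jmin; case: (j) j0 => //= j' _; rewrite ltnn.
  rewrite -ltNge -{2}(prednK j0) expnS natrM => lt2.
  have -> : 1 / eps = eps^-1 by rewrite div1r.
  lra.
have L2 : 2 <= 2 + 1 / eps :> R by rewrite div1r lerDl ltW.
have L0 : 0 < 2 + 1 / eps by apply: lt_le_trans L2.
rewrite mulr_natl -lnXn // -natrX.
apply: (@le_trans _ _ (ln (4 * (2 + 1 / eps)))).
  by rewrite ler_ln ?posrE ?mulr_gt0 // ltr0n expn_gt0.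
rewrite lnM ?posrE // (_ : 4 = 2 ^+ 2); last by rewrite -natrX.
rewrite lnXn //.
have : ln 2 <= ln (2 + 1 / eps) by rewrite ler_ln ?posrE.
rewrite mulr2n; lra.
Qed.

Theorem theorem1 (R : realType) :
  exists2 C : R, 0 < C &
    forall (n : nat) (eps delta : R) (p : nat) (A : {set 'F_p}),
      (1 < n)%N ->
      0 < eps -> eps < n%:R ->
      1 / (n%:R - eps) <= delta ->
      prime p -> (2 < p)%N ->
      p%:R `^ delta < #|A|%:R ->
      exists N : nat,
        [/\ (0 < N)%N,
            N%:R <= C * 4 ^+ n * ln (2 + 1 / eps)
          & sumset N (prodset n A) = [set: 'F_p]].
Proof.
have ln20 : 0 < ln 2 :> R by rewrite ln_gt0 // ltr1n.
(* 420 = 140 * 3, from the bounds of [powsum_eq_setT] and [exists_dyadic_scale]. *)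
exists (420 / ln 2); first by rewrite divr_gt0.
move=> n eps delta p A n1 eps0 epsn ledelta pp _ pA.
have [j [j0 jeps lej]] := exists_dyadic_scale eps0.
have [A1 hp] := natr_deficit eps0 epsn ledelta (prime_gt0 pp) pA jeps.
case: n n1 epsn ledelta hp => [|[|k]] // _ _ _ hp.
have [N [N0 leN NT]] := powsum_eq_setT pp A1 j0 hp.
exists N; split=> //.
apply: (@le_trans _ _ ((140 * j * 4 ^ k.+2)%:R)); first by rewrite ler_nat.
rewrite natrM natrX natrM -mulrA [j%:R * _]mulrC mulrA.
have -> : 420 / ln 2 * 4 ^+ k.+2 * ln (2 + 1 / eps) =
    140 * 4 ^+ k.+2 * (3 * ln (2 + 1 / eps) / ln 2).
  by field; rewrite gt_eqF.
apply: ler_wpM2l; first by rewrite mulr_ge0 ?exprn_ge0.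
by rewrite ler_pdivlMr.
Qed.
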